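(* Let $X_1,\dots,X_n$ be independent normally-distributed unbiased estimators of an unknown parameter $\theta$ with finite (positive) variances $\sigma_1^2,\dots,\sigma_n^2$, respectively. Then $\Theta=\operatorname{mean}(\&(N_1,\dots,N_n))$ is a maximum likelihood estimator for $\theta$ (based on $X_1,\dots,X_n$), where $N_1,\dots,N_n$ are the random normal distributions $N_i=N(X_i,\sigma_i^2)$, $i=1,\dots,n$.
   Context: A random variable $X$ is an unbiased estimator of $\theta$ if $E X=\theta$. If $X$ is a random variable, the random normal distribution $N(X,\sigma^2)$ is the normal distribution with variable (random) mean $X$ and fixed variance $\sigma^2$; for each realization of $X_1,\dots,X_n$ the conflation $\&(N_1,\dots,N_n)$ is formed, so it is a random probability distribution, and $\operatorname{mean}(\&(N_1,\dots,N_n))$, its mean, is a random variable. Conflation: $\delta_x$ is the Dirac measure at $x$, and $\|\mu\|$ is the total mass of a Borel sub-probability measure $\mu$. For Borel probability measures $P_1,\dots,P_n$ on $\mathbb{R}$ and $j\in\mathbb{N}$, define the sub-probability measure $$\mu_j(P_1,\dots,P_n)=\sum_{k\in\mathbb{Z}}\ \prod_{i=1}^n P_i\big(((k-1)2^{-j},k2^{-j}]\big)\,\delta_{k2^{-j}}.$$ If $\mu_j(P_1,\dots,P_n)/\|\mu_j(P_1,\dots,P_n)\|$ converges vaguely, as $j\to\infty$, to a Borel probability measure $Q$, then $Q$ is called the conflation of $P_1,\dots,P_n$ and is written $\&(P_1,\dots,P_n)$. Vague convergence $\nu_j\to\nu$ of sub-probability measures means $\int f\,d\nu_j\to\int f\,d\nu$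 for all continuous $f$ vanishing at infinity. *)

(* Defs.v *)
From HB Require Import structures.
From mathcomp Require Import all_boot all_order all_algebra.
From mathcomp Require Import all_classical all_reals all_analysis.

Set Implicit Arguments.
Unset Strict Implicit.
Unset Printing Implicit Defensive.

Import Order.TTheory GRing.Theory Num.Theory.
Import numFieldNormedType.Exports.

Local Open Scope classical_set_scope.
Local Open Scope ring_scope.

Section conflation.
Context {R : realType}.
(* the Borel structure carried by lebesgue_measure and normal_prob *)
Local Notation Rm := (measurableTypeR R).

Definition dyadic_weight n (P : 'I_n -> probability Rm R) (j : nat)
    (k : int) : R :=
  \prod_(i < n) fine (P i `](k - 1)%:~R * 2 ^- j, k%:~R * 2 ^- j]%classic).

Lemma dyadic_weight_ge0 n (P : 'I_n -> probability Rm R) j k :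
  0 <= dyadic_weight P j k.
Proof. by apply: prodr_ge0 => i _; rewrite fine_ge0. Qed.

Definition dyadic_atom n (P : 'I_n -> probability Rm R) (j : nat)
    (k : int) : {measure set Rm -> \bar R} :=
  mscale (NngNum (dyadic_weight_ge0 P j k)) \d_(k%:~R * 2 ^- j : Rm).

(* The sum over all k in Z: [Posz m] and [Negz m] for m : nat enumerate Z. *)
Definition dyadic_product n (P : 'I_n -> probability Rm R) (j : nat) :
    {measure set Rm -> \bar R} :=
  mseries (fun m => measure_add (dyadic_atom P j (Posz m))
                                (dyadic_atom P j (Negz m))) 0.

Lemma inv_mass_ge0 (mu : {measure set Rm -> \bar R}) :
  0 <= (fine (mu setT))^-1.
Proof. by rewrite invr_ge0 fine_ge0. Qed.

(* The zero measure normalizes to itself; a sequence that is zero infinitely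
   often then has no vague limit that is a probability. *)
Definition normalized (mu : {measure set Rm -> \bar R}) :
    {measure set Rm -> \bar R} :=
  mscale (NngNum (inv_mass_ge0 mu)) mu.

Definition vaguely_converges (nu : nat -> {measure set Rm -> \bar R})
    (Q : {measure set Rm -> \bar R}) :=
  forall f : R -> R, continuous f ->
    f x @[x --> +oo] --> (0 : R) -> f x @[x --> -oo] --> (0 : R) ->
    (\int[nu j]_x (f x)%:E)%E @[j --> \oo] --> (\int[Q]_x (f x)%:E)%E.

Definition is_conflation n (P : 'I_n -> probability Rm R)
    (Q : probability Rm R) :=
  vaguely_converges (fun j => normalized (dyadic_product P j)) Q.

Definition mean (Q : probability Rm R) : R := fine 'E_Q[idfun : Rm -> R].

End conflation.

Section cons_measure.
Context {R : realType} {n : nat}.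
Local Notation Rm := (measurableTypeR R).

Definition cons_pair (x : Rm * n.-tuple Rm) : n.+1.-tuple Rm :=
  [tuple of x.1 :: x.2].

Lemma measurable_cons_pair : measurable_fun setT cons_pair.
Proof. exact: measurable_cons. Qed.

HB.instance Definition _ :=
  isMeasurableFun.Build _ _ _ _ cons_pair measurable_cons_pair.

Definition uncons_pair (t : n.+1.-tuple Rm) : Rm * n.-tuple Rm :=
  (thead t, [tuple of behead t]).

Lemma cons_pairK : cancel cons_pair uncons_pair.
Proof.
by move=> [x t]; rewrite /uncons_pair theadE; congr pair; exact: val_inj.
Qed.

Lemma uncons_pairK : cancel uncons_pair cons_pair.
Proof. by move=> t; rewrite [RHS]tuple_eta; exact: val_inj. Qed.

Lemma measurable_uncons_pair : measurable_fun setT uncons_pair.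
Proof.
apply: measurable_fun_pair; last exact: measurable_behead.
exact: measurable_tnth.
Qed.

Variable mu : {sigma_finite_measure set (n.-tuple Rm) -> \bar R}.

Definition cons_measure : set (n.+1.-tuple Rm) -> \bar R :=
  pushforward (@lebesgue_measure R \x mu)%E cons_pair.

Let cons_measure0 : cons_measure set0 = 0%E.
Proof. exact: measure0. Qed.

Let cons_measure_ge0 A : (0 <= cons_measure A)%E.
Proof. exact: measure_ge0. Qed.

Let cons_measure_sigma_additive : semi_sigma_additive cons_measure.
Proof. exact: measure_semi_sigma_additive. Qed.

HB.instance Definition _ := isMeasure.Build _ _ _ cons_measure
  cons_measure0 cons_measure_ge0 cons_measure_sigma_additive.

Let cons_measure_sigma_finite : sigma_finite setT cons_measure.
Proof.
have /sigma_finiteP[F [FT ndF Foo]] := sigma_finiteT (@lebesgue_measure R).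
have /sigma_finiteP[G [GT ndG Goo]] := sigma_finiteT mu.
exists (fun i => uncons_pair @^-1` (F i `*` G i)).
  apply/esym; rewrite -subTset => t _.
  have [i _ Fi] : (\bigcup_i F i) (thead t) by rewrite -FT.
  have [j _ Gj] : (\bigcup_i G i) [tuple of behead t] by rewrite -GT.
  exists (maxn i j) => //; split => /=.
    by move: Fi; exact/subsetPset/ndF/leq_maxl.
  by move: Gj; exact/subsetPset/ndG/leq_maxr.
move=> i; have [mF Fi] := Foo i; have [mG Gi] := Goo i; split.
  rewrite -[X in measurable X]setTI; apply: measurable_uncons_pair => //.
  exact: measurableX.
rewrite /cons_measure /pushforward -comp_preimage.
rewrite (_ : uncons_pair \o cons_pair = idfun); last exact/funext/cons_pairK.
by rewrite preimage_id product_measure1E// lte_mul_pinfty// ge0_fin_numE.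
Qed.

HB.instance Definition _ := Measure_isSigmaFinite.Build _ _ _
  cons_measure cons_measure_sigma_finite.

End cons_measure.

(* n-dimensional Lebesgue measure, as the n-fold product measure *)
Fixpoint lebesgue_tuple (R : realType) (n : nat) :
    {sigma_finite_measure set (n.-tuple (measurableTypeR R)) -> \bar R} :=
  match n with
  | 0 => \d_([tuple] : 0.-tuple (measurableTypeR R))
  | m.+1 => cons_measure (lebesgue_tuple R m)
  end.
Arguments lebesgue_tuple {R} n.

Section statistics.
Context {R : realType} {d : measure_display} {T : measurableType d} {n : nat}.
Local Notation Rm := (measurableTypeR R).
Implicit Types (P : probability T R) (X : 'I_n -> {mfun T >-> R}).

(* Taking some of the B i to be setT gives the product rule for subfamilies. *)
Definition independent_RVs P X :=
  forall B : 'I_n -> set R, (forall i, measurable (B i)) ->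
    P (\bigcap_i (X i @^-1` B i)) = (\prod_(i < n) P (X i @^-1` B i))%E.

Definition has_normal_law P (Y : {mfun T >-> R}) :=
  exists m s : R, 0 < s /\
    forall A, measurable A -> distribution P Y A = normal_prob m s A.

Definition unbiased_estimator (P_ : R -> probability T R)
    (Y : {mfun T >-> R}) :=
  forall theta, ('E_(P_ theta)[Y] = theta%:E)%E.

Definition sample X (w : T) : n.-tuple Rm := [tuple X i w | i < n].

(* Joint densities are only determined almost everywhere, whereas likelihoods
   are evaluated at points: continuity selects at most one version. *)
Definition continuous_joint_density P X (f : n.-tuple Rm -> R) :=
  [/\ continuous (fun v : 'rV[R]_n => f [tuple v ord0 i | i < n]),
      measurable_fun setT f, (forall x, 0 <= f x)
    & forall A, measurable A ->
        P (sample X @^-1` A) = (\int[lebesgue_tuple n]_(x in A) (f x)%:E)%E].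

(* The parameter ranges over all of R; [f theta x] is the likelihood of theta
   given the observation x. *)
Definition is_MLE (P_ : R -> probability T R) X (Theta : T -> R) :=
  (exists2 h : n.-tuple Rm -> R,
     measurable_fun setT h & Theta = h \o sample X) /\
  exists2 f : R -> n.-tuple Rm -> R,
    forall theta, continuous_joint_density (P_ theta) X (f theta) &
    forall w theta, f theta (sample X w) <= f (Theta w) (sample X w).

End statistics.

(* Main.v *)
Require Import Defs.
From HB Require Import structures.
From mathcomp Require Import all_boot all_order all_algebra.
From mathcomp Require Import all_classical all_reals all_analysis.
From mathcomp Require Import measurable_realfun ring lra.

Import Order.TTheory GRing.Theory Num.Theory.
Import numFieldNormedType.Exports.

Local Open Scope classical_set_scope.
Local Open Scope ring_scope.

(** For fixed observations x_i, completing the square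
    ([sum_sqrB_weighted_mean]) shows that the product over i of the densities
    of N(x_i, s_i^2) is a positive constant times the density of a normal law
    N(m, s^2), where m is the mean of the x_i weighted by the 1/s_i^2
    ([prod_normal_pdf]). Both halves of the statement come from this identity.

    The conflation is the probability with density proportional to the product
    of the densities ([is_conflation_density]): once divided by the mesh
    2^-j, the mass of a dyadic cell under P_i is an average of the i-th density,
    so that integrals against the discrete measure mu_j are, up to a factor
    that normalization removes, Lebesgue integrals of step functions
    ([integral_dyadic_product]); these converge by continuity and dominated
    convergence ([cvg_integral_cell_average]). Hence N(m, s^2) is a conflation
    ([is_conflation_normal_prob]); vague limits that are probabilities are
    unique ([vague_limit_unique]), so every conflation has mean m, and
    Theta is the weighted mean of the observations.

    On the statistical side, a normal law is determined by its mean and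
    variance, so X_i has law N(theta, s_i^2) under theta
    ([has_normal_law_normal_prob]; this needs the first two moments of a normal
    law). By independence and Fubini's theorem the sample has the product of
    these densities as joint density ([independent_joint_density]). Since a
    normal density is symmetric in its mean and its argument, the likelihood
    is, as a function of theta, again a constant times a normal density
    centred at m, and it is maximal at theta = m
    ([prod_normal_pdf_le_weighted_mean]). *)

(** * Moments of the normal distribution *)

Section normal_moments.
Context {R : realType}.
Local Notation Rm := (measurableTypeR R).
Local Notation mu := (@lebesgue_measure R).

Lemma ge0_integral_normal_prob (m s : R) (f : R -> R) :
  measurable_fun setT f -> (forall x, 0 <= f x) ->
  (\int[normal_prob m s]_x (f x)%:E =
   \int[mu]_x (f x * normal_pdf m s x)%:E)%E.
Proof.
move=> mf f0.
have dom := normal_prob_dominates m s.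
have mpdf : measurable_fun [set: Rm] (fun x => (normal_pdf m s x)%:E).
  by apply/measurable_EFinP; exact: measurable_normal_pdf.
rewrite -(Radon_Nikodym_SigmaFinite.change_of_variables dom)//; last first.
  exact/measurable_EFinP.
have iRN := Radon_Nikodym_SigmaFinite.f_integrable dom.
apply: ae_eq_integral => //.
- apply: emeasurable_funM; first exact/measurable_EFinP.
  exact: measurable_int iRN.
- by apply/measurable_EFinP; apply: measurable_funM => //; exact: measurable_normal_pdf.
- rewrite (_ : (fun x => (f x * normal_pdf m s x)%:E) =
    (fun x => (f x)%:E * (normal_pdf m s x)%:E)%E)//.
  apply: ae_eqe_mul2l => /=.
  (* the density and the Radon-Nikodym derivative have the same integrals *)
  apply: integral_ae_eq => //=.
  by move=> E ET mE; rewrite -Radon_Nikodym_SigmaFinite.f_integral.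
Qed.

Lemma is_derive_normal_pdf (m s x : R) : s != 0 ->
  is_derive x 1 (normal_pdf m s) (- ((x - m) / s ^+ 2) * normal_pdf m s x).
Proof.
move=> s0; rewrite normal_pdfE// /normal_fun.
apply: is_derive_eq.
by rewrite /GRing.scale/=; field.
Qed.

Lemma ge0_cvg_integral_itv (c : R) (f : R -> R) :
  measurable_fun setT f -> (forall x, 0 <= f x) ->
  (\int[mu]_(x in `[(c - k.+1%:R)%R, (c + k.+1%:R)%R]) (f x)%:E)%E
    @[k --> \oo] --> (\int[mu]_x (f x)%:E)%E.
Proof.
move=> mf f0.
pose F k := `[c - k.+1%:R, c + k.+1%:R]%classic : set R.
have FT : \bigcup_k F k = setT.
  rewrite -subTset => x _.
  exists (Num.truncn `|x - c|) => //.
  rewrite /F/= in_itv/= -ler_distl distrC.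
  by rewrite distrC ltW// truncnS_gt.
rewrite -FT.
apply: (@ge0_nondecreasing_set_cvg_integral _ Rm _ F (EFin \o f) mu) => //.
- move=> i j ij; apply/subsetPset => x; rewrite /F/= !in_itv/= => /andP[h1 h2].
  have : i.+1%:R <= j.+1%:R :> R by rewrite ler_nat.
  by move=> h; apply/andP; split; lra.
- by move=> i; exact: measurable_itv.
- by move=> i; apply/measurable_EFinP; exact: measurable_funTS.
- by move=> i x _; rewrite /= lee_fin.
Qed.

Lemma integral_itv_is_derive (f F : R -> R) (a b : R) : a < b -> continuous f ->
  (forall x : R, is_derive x 1 F (f x)) ->
  (\int[mu]_(x in `[a, b]) (f x)%:E = (F b - F a)%:E)%E.
Proof.
move=> ab cf dF.
have cF : continuous F.
  move=> x; apply/differentiable_continuous/derivable1_diffP.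
  by have [] := dF x.
rewrite (@continuous_FTC2 _ f F)//.
- exact: continuous_subspaceT.
- split => //.
  + exact/cvg_at_right_filter/cF.
  + exact/cvg_at_left_filter/cF.
- by move=> x _; rewrite derive1E derive_val.
Qed.

Lemma cvg_natr_normal_pdf (m s : R) : s != 0 ->
  k.+1%:R * normal_pdf m s (m + k.+1%:R) @[k --> \oo] --> (0 : R).
Proof.
move=> s0.
have B k : 0 <= k.+1%:R * normal_pdf m s (m + k.+1%:R)
    <= normal_peak s * (s ^+ 2 *+ 2) * (k.+1%:R)^-1.
  apply/andP; split; first by rewrite mulr_ge0// normal_pdf_ge0.
  rewrite normal_pdfE// /normal_fun addrC addKr.
  set u : R := k.+1%:R.
  have u0 : 0 < u by rewrite ltr0n.
  have v0 : 0 < s ^+ 2 *+ 2 by rewrite pmulrn_lgt0// exprn_even_gt0.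
  set v := s ^+ 2 *+ 2 in v0 *.
  rewrite mulrCA -mulrA ler_wpM2l ?normal_peak_ge0//.
  rewrite mulNr expRN.
  (* expR dominates the identity, so the density at distance u from m is
     at most a constant times u^-2 *)
  have E : u ^+ 2 / v <= expR (u ^+ 2 / v).
    by apply: le_trans (expR_ge1Dx _); rewrite lerDr.
  have w0 : 0 < u ^+ 2 / v by rewrite divr_gt0// exprn_gt0.
  have E' : (expR (u ^+ 2 / v))^-1 <= (u ^+ 2 / v)^-1.
    by rewrite lef_pV2 ?posrE ?expR_gt0.
  apply: (le_trans (ler_wpM2l (ltW u0) E')).
  rewrite le_eqVlt; apply/orP; left; apply/eqP.
  by clearbody u v; field; rewrite !gt_eqF.
apply: (squeeze_cvgr (f := fun=> 0)
  (h := fun k => normal_peak s * (s ^+ 2 *+ 2) * (k.+1%:R)^-1)).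
- exact: nearW.
- exact: cvg_cst.
rewrite -[X in _ --> X](mulr0 (normal_peak s * (s ^+ 2 *+ 2))).
apply: cvgM; first exact: cvg_cst.
exact: cvg_harmonic.
Qed.

(** Computing the second moment about an arbitrary point [a] yields the variance
    (for a = m) and, by polarization, also the integrability of the identity
    and the mean. *)
Lemma integral_normal_pdf_sqrB (m s a : R) : s != 0 ->
  (\int[mu]_x ((x - a) ^+ 2 * normal_pdf m s x)%:E =
   (s ^+ 2 + (m - a) ^+ 2)%:E)%E.
Proof.
move=> s0; set q := normal_pdf m s.
pose K := s ^+ 2 + (m - a) ^+ 2.
(* [G] is a primitive of [f] below *)
pose G x := - s ^+ 2 * (x + m - 2 * a) * q x.
have cq : continuous q by exact: continuous_normal_pdf.
have csq : continuous (fun x : R => (x - a) ^+ 2).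
  move=> x; apply: (cvg_comp (fun x => x - a) (fun x => x ^+ 2)).
    by apply: (@cvgB _ R^o) => //; [exact: cvg_id|exact: cvg_cst].
  exact: sqr_continuous.
pose f x := (x - a) ^+ 2 * q x - K * q x.
have cf : continuous f.
  move=> x; apply: (@cvgB _ R^o).
    by apply: cvgM; [exact: csq|exact: cq].
  by apply: cvgM; [exact: cvg_cst|exact: cq].
have dG (x : R) : is_derive x 1 G (f x).
  have dq := is_derive_normal_pdf m s x s0.
  apply: is_derive_eq.
  by rewrite /f /K /q /GRing.scale/=; field.
have qsym t : q (m - t) = q (m + t).
  by rewrite /q normal_pdfE// /normal_fun !(addrC m) !addrK sqrrN.
have mq : measurable_fun setT q by exact: measurable_normal_pdf.
have msq : measurable_fun setT (fun x : R => (x - a) ^+ 2 * q x).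
  apply: measurable_funM => //; exact: continuous_measurable_fun.
have q0 x : 0 <= q x by exact: normal_pdf_ge0.
have E k : (\int[mu]_(x in `[(m - k.+1%:R)%R, (m + k.+1%:R)%R]) ((x - a) ^+ 2 * q x)%:E =
    K%:E * \int[mu]_(x in `[(m - k.+1%:R)%R, (m + k.+1%:R)%R]) (q x)%:E
    + (- 2 * s ^+ 2 * (k.+1%:R * q (m + k.+1%:R)))%:E)%E.
  set I := `[_, _]%classic.
  have mI : measurable I by exact: measurable_itv.
  have iq : mu.-integrable I (fun x => (q x)%:E).
    apply: (integrableS _ _ (subsetT _)) => //.
    exact: integrable_normal_pdf.
  have iKq : mu.-integrable I (fun x => (K * q x)%:E).
    by under eq_fun do rewrite EFinM; exact: integrableZl.
  have iF : mu.-integrable I (fun x => (f x)%:E).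
    apply: continuous_compact_integrable; first exact: segment_compact.
    exact: continuous_subspaceT.
  rewrite -integralZl//.
  transitivity (\int[mu]_(x in I) ((K * q x)%:E + (f x)%:E))%E.
    by apply: eq_integral => x _; rewrite -EFinD; congr EFin; rewrite /f; ring.
  rewrite integralD//; congr (_ + _)%E.
  rewrite (@integral_itv_is_derive f G)//; last first.
    have : 0 < k.+1%:R :> R by rewrite ltr0n.
    by move: (k.+1%:R : R) => t; lra.
  by congr EFin; rewrite /G qsym; ring.
have c1 := @ge0_cvg_integral_itv m _ msq (fun x => mulr_ge0 (sqr_ge0 (x - a)) (q0 x)).
have c2 : (K%:E * \int[mu]_(x in `[(m - k.+1%:R)%R, (m + k.+1%:R)%R]) (q x)%:E
    + (- 2 * s ^+ 2 * (k.+1%:R * q (m + k.+1%:R)))%:E)%E @[k --> \oo]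
    --> (K%:E * 1%:E + (- 2 * s ^+ 2 * 0)%:E)%E.
  apply: cvgeD => //.
    apply: cvgeZl => //.
    rewrite -(integral_normal_pdf m s).
    exact: ge0_cvg_integral_itv.
  apply: cvg_EFin; first exact: nearW.
  apply: cvgM; first exact: cvg_cst.
  exact: cvg_natr_normal_pdf.
rewrite mulr0 adde0 mule1 in c2.
apply: (cvg_unique _ c1) => //.
by apply: cvg_trans c2; apply: near_eq_cvg; apply: nearW => k /=; rewrite -E.
Qed.

End normal_moments.

Section normal_laws.
Context {R : realType}.
Local Notation Rm := (measurableTypeR R).
Local Notation mu := (@lebesgue_measure R).

Lemma integral_normal_prob_sqrB (m s a : R) : s != 0 ->
  (\int[normal_prob m s]_x ((x - a) ^+ 2)%:E = (s ^+ 2 + (m - a) ^+ 2)%:E)%E.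
Proof.
move=> s0; rewrite ge0_integral_normal_prob ?integral_normal_pdf_sqrB//.
- by apply: measurable_funX; apply: measurable_funB.
- by move=> x; exact: sqr_ge0.
Qed.

Lemma integrable_normal_prob_sqrB (m s a : R) : s != 0 ->
  (normal_prob m s).-integrable setT (fun x => ((x - a) ^+ 2)%:E).
Proof.
move=> s0; apply/integrableP; split.
  by apply/measurable_EFinP; apply: measurable_funX; apply: measurable_funB.
under eq_integral do rewrite /= ger0_norm ?sqr_ge0//.
by rewrite integral_normal_prob_sqrB// ltry.
Qed.

Lemma polarization_sqr (x : R) :
  x%:E = (4^-1%:E * (((x - - 1) ^+ 2)%:E - ((x - 1) ^+ 2)%:E))%E.
Proof. by rewrite -EFinB -EFinM; congr EFin; field. Qed.

Lemma integrable_normal_prob_id (m s : R) : s != 0 ->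
  (normal_prob m s).-integrable setT (fun x => x%:E).
Proof.
move=> s0; under eq_fun do rewrite polarization_sqr.
apply: integrableZl => //; apply: integrableB => //;
  exact: integrable_normal_prob_sqrB.
Qed.

Lemma integral_normal_prob_id (m s : R) : s != 0 ->
  (\int[normal_prob m s]_x x%:E = m%:E)%E.
Proof.
move=> s0; under eq_integral do rewrite polarization_sqr.
rewrite integralZl//; last first.
  by apply: integrableB => //; exact: integrable_normal_prob_sqrB.
rewrite integralB//; [|exact: integrable_normal_prob_sqrB..].
rewrite !integral_normal_prob_sqrB// [RHS]polarization_sqr; congr (_ * _)%E.
by rewrite -!EFinB; congr EFin; ring.
Qed.

Context {d : measure_display} {T : measurableType d} (P : probability T R).

Lemma normal_law_ge0_integral (Y : {mfun T >-> R}) (m s : R) (f : R -> \bar R) :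
  (forall A, measurable A -> distribution P Y A = normal_prob m s A) ->
  measurable_fun [set: R] f -> (forall x, (0 <= f x)%E) ->
  (\int[P]_w f (Y w) = \int[normal_prob m s]_x f x)%E.
Proof.
move=> YN mf f0.
(* [R] and [Rm] have the same measurable sets but different displays *)
have mY : measurable_fun [set: T] (Y : T -> Rm) by move=> mT A mA; exact: (measurable_funPT Y).
pose Y' : {mfun T >-> Rm} := @mfun_Sub _ _ T Rm Y (mem_set mY).
have := @ge0_integral_distribution _ _ _ Rm _ P Y' f mf f0.
have := @eq_measure_integral _ Rm R setT (normal_prob m s) (distribution P Y') f.
move=> -> // A mA _; exact: YN.
Qed.

Lemma normal_law_expectation (Y : {mfun T >-> R}) (m s : R) : s != 0 ->
  (forall A, measurable A -> distribution P Y A = normal_prob m s A) ->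
  ('E_P[Y] = m%:E)%E.
Proof.
move=> s0 YN; rewrite unlock -(integral_normal_prob_id m s s0).
rewrite integralE [RHS]integralE; congr (_ - _)%E.
  rewrite -(normal_law_ge0_integral Y m s _ YN)//.
    by apply: eq_integral => x _; rewrite !funeposE.
  by apply: measurable_funepos; exact/measurable_EFinP.
rewrite -(normal_law_ge0_integral Y m s _ YN)//.
  by apply: eq_integral => x _; rewrite !funenegE.
by apply: measurable_funeneg; exact/measurable_EFinP.
Qed.

Lemma normal_law_variance (Y : {mfun T >-> R}) (m s : R) : s != 0 ->
  (forall A, measurable A -> distribution P Y A = normal_prob m s A) ->
  ('V_P[Y] = (s ^+ 2)%:E)%E.
Proof.
move=> s0 YN; rewrite /variance covariance.unlock (normal_law_expectation Y m s s0 YN)/=.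
rewrite expectation.unlock.
rewrite (_ : s ^+ 2 = s ^+ 2 + (m - m) ^+ 2)//; last by rewrite subrr expr0n addr0.
rewrite -integral_normal_prob_sqrB//.
rewrite -(normal_law_ge0_integral Y m s _ YN)//.
- apply/measurable_EFinP; apply: measurable_funX; apply: measurable_funB => //.
- by move=> x; rewrite lee_fin sqr_ge0.
Qed.

(** A normal law is determined by its mean and variance. *)
Lemma has_normal_law_normal_prob (Y : {mfun T >-> R}) (m s : R) :
  has_normal_law P Y -> 0 < s -> ('E_P[Y] = m%:E)%E -> ('V_P[Y] = (s ^+ 2)%:E)%E ->
  forall A, measurable A -> P (Y @^-1` A) = normal_prob m s A.
Proof.
move=> [m' [s' [s'0 YN]]] s0 Em Vs.
have s'n0 : s' != 0 by rewrite gt_eqF.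
have := normal_law_expectation Y m' s' s'n0 YN.
rewrite Em => -[->].
have := normal_law_variance Y m' s' s'n0 YN.
rewrite Vs => -[/eqP]; rewrite eqrXn2 ?ltW// => /eqP ->.
exact: YN.
Qed.

End normal_laws.

(** * Products of normal densities *)

Section product_of_normal_densities.
Context {R : realType} {n : nat}.
Implicit Types (x s : 'I_n -> R).

(** Total precision: the sum of the inverse variances. *)
Definition precision s : R := \sum_i (s i ^+ 2)^-1.

(** Mean of the [x i], weighted by the inverse variances. *)
Definition weighted_mean s x : R := (\sum_i x i / s i ^+ 2) / precision s.

(** Standard deviation of the normal law whose variance is the inverse of the
    total precision. *)
Definition pooled_sd s : R := Num.sqrt (precision s)^-1.

Lemma precision_gt0 s : (0 < n)%N -> (forall i, 0 < s i) -> 0 < precision s.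
Proof.
move=> n0 s0; rewrite /precision (bigD1 (Ordinal n0))//= ltr_pwDl//.
  by rewrite invr_gt0 exprn_gt0.
by apply: sumr_ge0 => i _; rewrite invr_ge0 sqr_ge0.
Qed.

Lemma pooled_sd_gt0 s : (0 < n)%N -> (forall i, 0 < s i) -> 0 < pooled_sd s.
Proof. by move=> n0 s0; rewrite sqrtr_gt0 invr_gt0 precision_gt0. Qed.

Lemma sum_sqrB_weighted_mean s x (t : R) : precision s != 0 ->
  \sum_i (t - x i) ^+ 2 / s i ^+ 2 =
  (t - weighted_mean s x) ^+ 2 * precision s
  + \sum_i (weighted_mean s x - x i) ^+ 2 / s i ^+ 2.
Proof.
move=> A0; set m := weighted_mean s x.
have E i : (t - x i) ^+ 2 / s i ^+ 2 =
    (t - m) ^+ 2 * (s i ^+ 2)^-1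
    + 2 * (t - m) * (m * (s i ^+ 2)^-1 - x i / s i ^+ 2)
    + (m - x i) ^+ 2 / s i ^+ 2.
  by move: (_^-1) => a; ring.
rewrite (eq_bigr _ (fun i _ => E i)) !big_split/= -!mulr_sumr.
rewrite sumrB -mulr_sumr -/(precision s).
by rewrite /m /weighted_mean divfK// subrr mulr0 addr0.
Qed.

Lemma prod_normal_pdf s x : (0 < n)%N -> (forall i, 0 < s i) ->
  exists2 c : R, 0 < c & forall t,
    \prod_i normal_pdf (x i) (s i) t =
    c * normal_pdf (weighted_mean s x) (pooled_sd s) t.
Proof.
move=> n0 s0.
have A0 := precision_gt0 s n0 s0; have S0 := pooled_sd_gt0 s n0 s0.
set m := weighted_mean s x.
pose K := \sum_i (m - x i) ^+ 2 / s i ^+ 2.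
exists ((\prod_i normal_peak (s i)) * expR (- (K / 2)) / normal_peak (pooled_sd s)).
  rewrite divr_gt0 ?normal_peak_gt0 ?gt_eqF// mulr_gt0 ?expR_gt0//.
  by apply: prodr_gt0 => i _; rewrite normal_peak_gt0 ?gt_eqF.
move=> t.
under eq_bigr => i _ do rewrite normal_pdfE ?gt_eqF//.
rewrite big_split/= normal_pdfE ?gt_eqF//.
rewrite [RHS]mulrA divfK ?gt_eqF ?normal_peak_gt0 ?gt_eqF// -[RHS]mulrA; congr (_ * _).
rewrite /normal_fun -expR_sum -expRD; congr expR.
transitivity (- ((\sum_i (t - x i) ^+ 2 / s i ^+ 2) / 2)).
  rewrite mulr_suml -sumrN; apply: eq_bigr => i _.
  by field; rewrite gt_eqF.
rewrite sum_sqrB_weighted_mean ?gt_eqF// -/m -/K.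
rewrite sqr_sqrtr ?invr_ge0 ?ltW//.
by field; rewrite gt_eqF.
Qed.

Lemma prod_normal_pdf_le_weighted_mean s x (t : R) :
  (0 < n)%N -> (forall i, 0 < s i) ->
  \prod_i normal_pdf t (s i) (x i) <=
  \prod_i normal_pdf (weighted_mean s x) (s i) (x i).
Proof.
move=> n0 s0.
(* a normal density is symmetric in its mean and its argument *)
have E u : \prod_i normal_pdf u (s i) (x i) = \prod_i normal_pdf (x i) (s i) u.
  apply: eq_bigr => i _.
  by rewrite !normal_pdfE ?gt_eqF// /normal_fun -sqrrN opprB.
have [c c0 cE] := prod_normal_pdf s x n0 s0.
rewrite (E t) (E (weighted_mean s x)) (cE t) (cE (weighted_mean s x)) ler_pM2l//.
have S0 := pooled_sd_gt0 s n0 s0.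
apply: (le_trans (normal_pdf_ub _ _ _)); first by rewrite gt_eqF.
by rewrite normal_pdfE ?gt_eqF// /normal_fun subrr expr0n/= oppr0 mul0r expR0 mulr1.
Qed.

End product_of_normal_densities.

(** * Uniqueness of vague limits *)

Section vague_limit_unique.
Context {R : realType}.
Local Notation Rm := (measurableTypeR R).

(** Compactly supported piecewise affine functions, which converge pointwise to
    the indicator function of ]a, b] when [k] tends to infinity; the asymmetric
    shape (0 at a, but 1 at b for large [k]) makes the limit right at both endpoints. *)
Definition trapezoid (a b : R) (k : nat) (x : R) : R :=
  Num.max 0 (Num.min 1 (Num.min (k.+1%:R * (x - a)) (1 + k.+1%:R * (b - x)))).

Lemma continuous_trapezoid a b k : continuous (trapezoid a b k).
Proof.
move=> x; apply: (@continuous_max R R (fun=> 0) (fun x => Num.min 1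
  (Num.min (k.+1%:R * (x - a)) (1 + k.+1%:R * (b - x))))); first exact: cvg_cst.
apply: (@continuous_min R R (fun=> 1) (fun x =>
  Num.min (k.+1%:R * (x - a)) (1 + k.+1%:R * (b - x)))); first exact: cvg_cst.
apply: (@continuous_min R R (fun x => k.+1%:R * (x - a))
  (fun x => 1 + k.+1%:R * (b - x))).
  apply: cvgM; first exact: cvg_cst.
  by apply: (@cvgB _ R^o); [exact: cvg_id|exact: cvg_cst].
apply: (@cvgD _ R^o); first exact: cvg_cst.
apply: cvgM; first exact: cvg_cst.
by apply: (@cvgB _ R^o); [exact: cvg_cst|exact: cvg_id].
Qed.

Lemma trapezoid_itv a b k x : 0 <= trapezoid a b k x <= 1.
Proof.
rewrite /trapezoid le_max lexx/= ge_max ler01/=.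
by rewrite ge_min lexx.
Qed.

Lemma trapezoid_eq0l a b k x : x <= a -> trapezoid a b k x = 0.
Proof.
move=> xa; apply/max_idPl.
by rewrite !ge_min; apply/orP; right; rewrite mulr_ge0_le0// subr_le0.
Qed.

Lemma trapezoid_eq0r a b k x : b + 1 <= x -> trapezoid a b k x = 0.
Proof.
move=> bx; apply/max_idPl; rewrite !ge_min; apply/orP; right; apply/orP; right.
have : 1 <= k.+1%:R :> R by rewrite ler1n.
by move: (k.+1%:R : R) => u; nra.
Qed.

Lemma cvg_trapezoid a b x :
  trapezoid a b k x @[k --> \oo] --> (\1_`]a, b]%classic x : R).
Proof.
have ev (e : R) : 0 < e -> \forall k \near \oo, 1 <= k.+1%:R * e.
  move=> e0; exists (Num.truncn e^-1) => // k /= hk.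
  rewrite -ler_pdivrMr// mul1r (le_trans (ltW (truncnS_gt _)))//.
  by rewrite ler_nat ltnS.
rewrite indicE; have [xa|ax] := leP x a.
  rewrite memNset; last by rewrite /= in_itv/= ltNge xa.
  by under eq_fun do rewrite trapezoid_eq0l//; exact: cvg_cst.
have [xb|bx] := leP x b.
  rewrite mem_set; last by rewrite /= in_itv/= ax.
  rewrite -subr_gt0 in ax.
  apply: cvg_near_cst; apply: filterS (ev _ ax) => k hk.
  rewrite /trapezoid (min_idPl _) ?(max_idPr _)//.
  by rewrite le_min hk lerDl mulr_ge0// subr_ge0.
rewrite memNset; last by rewrite /= in_itv/= [x <= b]leNgt bx andbF.
rewrite -subr_gt0 in bx.
apply: cvg_near_cst; apply: filterS (ev _ bx) => k hk.
apply/max_idPl; rewrite !ge_min; apply/orP; right; apply/orP; right.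
by rewrite -opprB mulrN subr_le0.
Qed.

Lemma vague_limit_unique (nu : nat -> {measure set Rm -> \bar R})
    (Q1 Q2 : probability Rm R) :
  vaguely_converges nu Q1 -> vaguely_converges nu Q2 ->
  forall A, measurable A -> Q1 A = Q2 A.
Proof.
move=> h1 h2.
have E a b k : (\int[Q1]_x (trapezoid a b k x)%:E =
    \int[Q2]_x (trapezoid a b k x)%:E)%E.
  have c := @continuous_trapezoid a b k.
  have cy : trapezoid a b k x @[x --> +oo] --> 0.
    apply: cvg_near_cst; near=> x; apply: trapezoid_eq0r.
    near: x; apply: nbhs_pinfty_ge; exact: num_real.
  have cNy : trapezoid a b k x @[x --> -oo] --> 0.
    apply: cvg_near_cst; near=> x; apply: trapezoid_eq0l.
    near: x; apply: nbhs_ninfty_le; exact: num_real.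
  by apply: cvg_unique (h1 _ c cy cNy) (h2 _ c cy cNy).
have lim (Q : probability Rm R) a b :
    (\int[Q]_x (trapezoid a b k x)%:E)%E @[k --> \oo] --> Q `]a, b]%classic.
  have mab : measurable (`]a, b]%classic : set Rm) by exact: measurable_itv.
  rewrite (_ : Q `]a, b]%classic = \int[Q]_x (\1_`]a, b]%classic x)%:E)%E; last first.
    by rewrite integral_indic// setIT.
  have [] := @dominated_convergence _ Rm R Q setT measurableT
    (fun k x => (trapezoid a b k x)%:E) (fun x => (\1_`]a, b]%classic x)%:E)
    (fun=> 1%E) => //.
  - move=> k; apply/measurable_EFinP; apply: continuous_measurable_fun.
    exact: continuous_trapezoid.
  - exact/measurable_EFinP.
  - apply: aeW => x _; apply: cvg_EFin; first exact: nearW.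
    exact: cvg_trapezoid.
  - exact: finite_measure_integrable_cst.
  - apply: aeW => x k _; rewrite lee_fin.
    by have /andP[h0 h3] := trapezoid_itv a b k x; rewrite ger0_norm.
pose g (k : nat) : set Rm := `](- k%:R), k%:R]%classic.
apply: (@measure_unique _ R Rm (@ocitv R) g) => //.
- exact: ocitvI.
- by move=> k; exact: is_ocitv.
- rewrite -subTset => x _; exists (Num.truncn `|x|).+1 => //.
  rewrite /g/= in_itv/=.
  have := truncnS_gt `|x|; rewrite ltr_norml => /andP[-> /ltW].
  by [].
- move=> _ [[a b] _ <-] /=; apply: cvg_unique (lim Q1 a b) _ => //.
  apply: cvg_trans (lim Q2 a b); apply: near_eq_cvg; apply: nearW => k /=.
  by rewrite E.
- by move=> k; rewrite (le_lt_trans (probability_le1 _ _))// ?ltry//; exact: measurable_itv.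
Unshelve. all: by end_near. Qed.

End vague_limit_unique.

(** * Joint density of an independent sample *)

Section density_measure.
Context {d} {T : measurableType d} {R : realType}.
Variables (mu : {measure set T -> \bar R}) (f : T -> R).
Hypotheses (mf : measurable_fun setT f) (f0 : forall x, 0 <= f x).

(** The measure with density [f] with respect to [mu]; the proofs are arguments
    so that the measure structure can be attached to it. *)
Definition density_measure of measurable_fun setT f & (forall x, 0 <= f x) :=
  fun A : set T => (\int[mu]_(x in A) (f x)%:E)%E.

Local Notation nu := (density_measure mf f0).

Let nu0 : nu set0 = 0%E.
Proof. exact: integral_set0. Qed.

Let nu_ge0 A : (0 <= nu A)%E.
Proof. by apply: integral_ge0 => x _; rewrite lee_fin. Qed.

Let nu_sigma_additive : semi_sigma_additive nu.
Proof.
move=> F mF tF mUF; rewrite /density_measure ge0_integral_bigcup//.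
- by apply: is_cvg_ereal_nneg_natsum_cond => k _ _; exact: nu_ge0.
- by apply/measurable_EFinP; exact: measurable_funTS.
- by move=> x _; rewrite lee_fin.
Qed.

HB.instance Definition _ := isMeasure.Build _ _ _ nu nu0 nu_ge0 nu_sigma_additive.

End density_measure.

Section tuple_rectangles.
Context {d} {T : measurableType d} {R : realType} {n : nat}.

(** The product of the sets [B i], as a set of tuples. *)
Definition rectangle (B : 'I_n -> set T) : set (n.-tuple T) :=
  [set t | forall i, B i (tnth t i)].

(** The pi-system of the rectangles with measurable sides. *)
Definition measurable_rectangle : set (set (n.-tuple T)) :=
  [set A | exists2 B, (forall i, measurable (B i)) & A = rectangle B].

Lemma rectangleE (B : 'I_n -> set T) :
  rectangle B = \bigcap_(i in setT) ((fun t => tnth t i) @^-1` B i).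
Proof. by apply/seteqP; split => t /= h i; [move=> _|]; exact: h. Qed.

Lemma measurable_rectangle_measurable A : measurable_rectangle A -> measurable A.
Proof.
move=> [B mB ->]; rewrite rectangleE; apply: fin_bigcap_measurable => // i _.
by rewrite -[X in measurable X]setTI; exact: measurable_tnth.
Qed.

Lemma measurable_rectangleI : setI_closed measurable_rectangle.
Proof.
move=> _ _ [B mB ->] [C mC ->]; exists (fun i => B i `&` C i).
  by move=> i; exact: measurableI.
apply/seteqP; split => [t [h1 h2] i|t h]; first by split; [exact: h1|exact: h2].
by split => i; have [] := h i.
Qed.

Lemma measurable_rectangleT : measurable_rectangle setT.
Proof. by exists (fun=> setT) => //; apply/seteqP; split. Qed.

Lemma measurable_tupleE : measurable = <<s measurable_rectangle >>.
Proof.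
apply/seteqP; split.
  apply: smallest_sub; first exact: smallest_sigma_algebra.
  move=> A; rewrite -bigcup_seq => -[i _ [B mB <-]].
  apply: sub_sigma_algebra; rewrite setTI.
  exists (fun j => if j == i then B else setT).
    by move=> j; case: ifP.
  apply/seteqP; split => t /=; first by move=> Bt j; case: eqP => // ->.
  by move=> /(_ i); rewrite eqxx.
apply: smallest_sub; first exact: sigma_algebra_measurable.
exact: measurable_rectangle_measurable.
Qed.

Lemma measure_rectangle_unique (m1 m2 : {measure set (n.-tuple T) -> \bar R}) :
  (m1 setT < +oo)%E ->
  (forall B, (forall i, measurable (B i)) -> m1 (rectangle B) = m2 (rectangle B)) ->
  forall A, measurable A -> m1 A = m2 A.
Proof.
move=> m1oo m12; apply: (measure_unique measurable_rectangle (fun=> setT)) => //.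
- exact: measurable_tupleE.
- exact: measurable_rectangleI.
- by move=> _; exact: measurable_rectangleT.
- by apply/seteqP; split => // t _; exists 0%N.
- by move=> _ [B mB ->]; exact: m12.
Qed.

End tuple_rectangles.

Section lebesgue_tuple_integral.
Context {R : realType}.
Local Notation Rm := (measurableTypeR R).
Local Notation mu := (@lebesgue_measure R).

Lemma measurable_prod_tnth n (q : 'I_n -> R -> R) :
  (forall i, measurable_fun [set: R] (q i)) ->
  measurable_fun [set: n.-tuple Rm] (fun t => \prod_i q i (tnth t i)).
Proof.
move=> mq; apply: measurable_prod => i _.
have mqi : measurable_fun [set: Rm] (q i) by exact: mq.
exact: (measurableT_comp mqi (@measurable_tnth _ Rm n i)).
Qed.

(** Fubini's theorem for products of functions of one coordinate. *)
Lemma integral_lebesgue_tuple_prod n (q : 'I_n -> R -> R) :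
  (forall i, measurable_fun [set: R] (q i)) -> (forall i x, 0 <= q i x) ->
  (\int[lebesgue_tuple n]_t (\prod_i q i (tnth t i))%:E =
   \prod_(i < n) \int[mu]_x (q i x)%:E)%E.
Proof.
elim: n q => [|n ih] q mq q0.
  rewrite big_ord0; under eq_integral do rewrite big_ord0.
  by rewrite integral_cst//= diracT mule1.
rewrite big_ord_recl/=.
have m1 := measurable_prod_tnth n.+1 q mq.
pose q' i := q (lift ord0 i).
have mq' i : measurable_fun [set: R] (q' i) by exact: mq.
have m2 := measurable_prod_tnth n q' mq'.
have p0 t : 0 <= \prod_i q' i (tnth t i) by apply: prodr_ge0 => i _; exact: q0.
rewrite ge0_integral_pushforward//; last 2 first.
- exact/measurable_EFinP.
- by move=> t _; rewrite lee_fin; apply: prodr_ge0 => i _; exact: q0.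
rewrite preimage_setT.
pose g (z : Rm * n.-tuple Rm) : \bar R :=
  (q ord0 z.1 * \prod_i q' i (tnth z.2 i))%:E.
rewrite (_ : _ \o _ = g); last first.
  apply/funext => z; rewrite /g /= big_ord_recl tnth0; congr (_ * _)%:E.
  by apply: eq_bigr => i _; rewrite tnthS.
rewrite fubini_tonelli1//=; last 2 first.
- apply/measurable_EFinP; apply: measurable_funM.
    apply: (@measurableT_comp _ _ _ _ Rm _ (q ord0)) => //; exact: mq.
  exact: (measurableT_comp m2).
- by move=> z; rewrite lee_fin mulr_ge0.
rewrite /fubini_F /g /=.
transitivity (\int[mu]_x ((q ord0 x)%:E * \prod_(i < n) \int[mu]_y (q' i y)%:E))%E.
  apply: eq_integral => x _ /=.
  under eq_integral do rewrite EFinM.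
  rewrite ge0_integralZl//; last 3 first.
  - exact/measurable_EFinP.
  - by move=> t _; rewrite lee_fin.
  - by rewrite lee_fin.
  by rewrite ih// => i y; exact: q0.
rewrite ge0_integralZr//.
- by apply/measurable_EFinP; exact: mq.
- by move=> x _; rewrite lee_fin.
- by apply: prode_ge0 => i _; apply: integral_ge0 => x _; rewrite lee_fin; exact: q0.
Qed.

Lemma integral_lebesgue_tuple_rectangle n (q : 'I_n -> R -> R) (B : 'I_n -> set Rm) :
  (forall i, measurable (B i)) ->
  (forall i, measurable_fun [set: R] (q i)) -> (forall i x, 0 <= q i x) ->
  (\int[lebesgue_tuple n]_(t in rectangle B) (\prod_i q i (tnth t i))%:E =
   \prod_(i < n) \int[mu]_(x in B i) (q i x)%:E)%E.
Proof.
move=> mB mq q0.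
(* move the constraint t_i in B_i into the i-th factor *)
pose p i := q i \_ (B i).
have mp i : measurable_fun [set: R] (p i).
  have mqi : measurable_fun [set: Rm] (q i) by exact: mq.
  have := (measurable_restrictT (q i) (mB i)).1; apply.
  exact: measurable_funTS.
have p0 i x : 0 <= p i x by rewrite /p /patch; case: ifP.
rewrite integral_mkcond.
transitivity (\int[lebesgue_tuple n]_t (\prod_i p i (tnth t i))%:E)%E.
  apply: eq_integral => t _; rewrite /patch; case: ifPn.
    rewrite inE => h; congr EFin; apply: eq_bigr => i _.
    by rewrite /p /patch mem_set//; exact: h.
  move=> /negP h.
  have [i nBi] : exists i, ~ B i (tnth t i).
    by apply/not_existsP => h'; apply: h; rewrite inE => i; have /contrapT := h' i.
  by rewrite (bigD1 i)//= {1}/p /patch memNset// mul0r.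
rewrite integral_lebesgue_tuple_prod//; apply: eq_bigr => i _.
by rewrite [RHS]integral_mkcond restrict_EFin.
Qed.

End lebesgue_tuple_integral.

Section joint_density.
Context {R : realType} {d : measure_display} {T : measurableType d} {n : nat}.
Local Notation Rm := (measurableTypeR R).
Local Notation mu := (@lebesgue_measure R).
Variables (P : probability T R) (X : 'I_n -> {mfun T >-> R}).

Lemma measurable_sample : measurable_fun setT (sample X).
Proof.
apply/measurable_fun_tnthP => i.
rewrite (_ : _ \o _ = X i); last by apply/funext => w /=; rewrite tnth_mktuple.
by move=> mT A mA; exact: (measurable_funPT (X i)).
Qed.

Lemma independent_joint_density (q : 'I_n -> R -> R) :
  independent_RVs P X ->
  (forall i, measurable_fun [set: R] (q i)) -> (forall i x, 0 <= q i x) ->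
  (forall i A, measurable A -> P (X i @^-1` A) = (\int[mu]_(x in A) (q i x)%:E)%E) ->
  forall A, measurable A ->
  P (sample X @^-1` A) =
  (\int[lebesgue_tuple n]_(t in A) (\prod_i q i (tnth t i))%:E)%E.
Proof.
move=> indep mq q0 XE.
have mp := measurable_prod_tnth n q mq.
have p0 t : 0 <= \prod_i q i (tnth t i) by apply: prodr_ge0 => i _; exact: q0.
pose S : {mfun T >-> n.-tuple Rm} := mfun_Sub (mem_set measurable_sample).
apply: (measure_rectangle_unique (distribution P S)
  (density_measure (lebesgue_tuple n) _ mp p0)).
  by rewrite (le_lt_trans (probability_le1 _ _))// ltry.
move=> B mB; transitivity (\prod_(i < n) \int[mu]_(x in B i) (q i x)%:E)%E; last first.
  exact/esym/integral_lebesgue_tuple_rectangle.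
transitivity (P (\bigcap_i (X i @^-1` B i))).
  rewrite -[LHS]/(P (sample X @^-1` rectangle B)); congr (P _).
  apply/seteqP; split => w /= h i.
    by move=> _; have := h i; rewrite tnth_mktuple.
  by rewrite tnth_mktuple; exact: h.
rewrite indep; last by move=> i; exact: mB.
by apply: eq_bigr => i _; rewrite (XE i (B i) (mB i)).
Qed.

End joint_density.

(** * Dyadic cells *)

Section dyadic_cells.
Context {R : realType}.
Local Notation Rm := (measurableTypeR R).
Local Notation mu := (@lebesgue_measure R).

(** The k-th dyadic interval ](k - 1) 2^-j, k 2^-j] of mesh 2^-j. *)
Definition dyadic_cell (j : nat) (k : int) : set Rm :=
  `](k - 1)%:~R * 2 ^- j, k%:~R * 2 ^- j]%classic.

(** The index of the dyadic interval of mesh 2^-j that contains [y]. *)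
Definition dyadic_index (j : nat) (y : R) : int := Num.ceil (y * 2 ^+ j).

Lemma dyadic_cellP j k y : dyadic_cell j k y <-> dyadic_index j y = k.
Proof.
have p0 : 0 < 2 ^+ j :> R by rewrite exprn_gt0.
rewrite /dyadic_cell/= in_itv/= ltr_pdivrMr// ler_pdivlMr//.
by split => [h|<-]; [exact: ceil_def|exact: ceil_itv].
Qed.

Lemma measurable_dyadic_cell j k : measurable (dyadic_cell j k).
Proof. exact: measurable_itv. Qed.

Lemma lebesgue_measure_dyadic_cell j k : mu (dyadic_cell j k) = (2 ^- j)%:E.
Proof.
rewrite /dyadic_cell lebesgue_measure_itv/= lte_fin.
have p0 : 0 < 2 ^- j :> R by rewrite invr_gt0 exprn_gt0.
rewrite ltr_pM2r// ltr_int ltrBlDr ltrDl ltr01 -EFinB -mulrBl -intrB opprB.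
by rewrite addrC subrK mul1r.
Qed.

Lemma trivIset_dyadic_cell j k l : k != l ->
  dyadic_cell j k `&` dyadic_cell j l = set0.
Proof.
move=> kl; apply/seteqP; split => // y [/dyadic_cellP Ek /dyadic_cellP El].
by move: kl; rewrite -Ek -El eqxx.
Qed.

(** Pairs of cells: the enumeration of Z by nat in which [dyadic_product] sums
    its atoms two at a time. *)
Definition dyadic_cell2 j (m : nat) : set Rm :=
  dyadic_cell j (Posz m) `|` dyadic_cell j (Negz m).

Lemma bigcup_dyadic_cell2 j : \bigcup_m dyadic_cell2 j m = setT.
Proof.
rewrite -subTset => y _.
have : dyadic_cell j (dyadic_index j y) y by apply/dyadic_cellP.
by case: (dyadic_index j y) => m hm; exists m => //; [left|right].
Qed.

Lemma measurable_dyadic_cell2 j m : measurable (dyadic_cell2 j m).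
Proof. by apply: measurableU; exact: measurable_dyadic_cell. Qed.

Lemma trivIset_dyadic_cell2 j : trivIset setT (dyadic_cell2 j).
Proof.
by move=> m l _ _ [y [[/dyadic_cellP E1|/dyadic_cellP E1]
  [/dyadic_cellP|/dyadic_cellP]]]; rewrite E1 => -[].
Qed.

Lemma measurable_dyadic_index j (g : int -> R) :
  measurable_fun [set: R] (g \o dyadic_index j).
Proof.
have mcell k : measurable_fun (dyadic_cell j k) (g \o dyadic_index j).
  apply: (eq_measurable_fun (fun=> g k)) => //.
  by move=> y /[!inE] /dyadic_cellP /= ->.
have := (@measurable_fun_bigcup _ _ Rm R _ (g \o dyadic_index j)
  (measurable_dyadic_cell2 j)).2.
rewrite bigcup_dyadic_cell2; apply => m.
by apply/measurable_funU; [exact: measurable_dyadic_cell..|split].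
Qed.

Lemma integral_dyadic_index j (g : int -> R) : (forall k, 0 <= g k) ->
  (\int[mu]_y (g (dyadic_index j y))%:E =
   \sum_(0 <= m <oo) ((g (Posz m) * 2 ^- j)%:E + (g (Negz m) * 2 ^- j)%:E))%E.
Proof.
move=> g0.
have mg := measurable_dyadic_index j g.
have cellE k : (\int[mu]_(y in dyadic_cell j k) (g (dyadic_index j y))%:E =
    (g k * 2 ^- j)%:E)%E.
  transitivity (\int[mu]_(y in dyadic_cell j k) (g k)%:E)%E.
    by apply: eq_integral => y /[!inE] /dyadic_cellP ->.
  rewrite integral_cst; last exact: measurable_dyadic_cell.
  by rewrite EFinM; congr (_ * _)%E; exact: lebesgue_measure_dyadic_cell.
rewrite -(bigcup_dyadic_cell2 j) ge0_integral_bigcup//.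
- apply: eq_eseriesr => m _; rewrite /dyadic_cell2 ge0_integral_setU//.
  + by rewrite !cellE.
  + exact: measurable_dyadic_cell.
  + exact: measurable_dyadic_cell.
  + by apply/measurable_EFinP; exact: measurable_funTS.
  + by move=> y _; rewrite lee_fin.
  + by apply/eqP; exact: trivIset_dyadic_cell.
- exact: measurable_dyadic_cell2.
- by apply/measurable_EFinP; exact: measurable_funTS.
- by move=> y _; rewrite lee_fin.
- exact: trivIset_dyadic_cell2.
Qed.

(** An integral against the discrete measure is the Lebesgue integral of a step
    function constant on the dyadic cells. *)
Lemma integral_dyadic_product n (P : 'I_n -> probability Rm R) j (f : R -> R) :
  measurable_fun [set: R] f -> (forall y, 0 <= f y) ->
  (\int[dyadic_product P j]_y (f y)%:E =
   (2 ^+ j)%:E * \int[mu]_y (f ((dyadic_index j y)%:~R * 2 ^- j) *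
     dyadic_weight P j (dyadic_index j y))%:E)%E.
Proof.
move=> mf f0.
pose g k := f (k%:~R * 2 ^- j) * dyadic_weight P j k.
have g0 k : 0 <= g k by rewrite mulr_ge0// dyadic_weight_ge0.
have mEf : measurable_fun [set: Rm] (fun y : Rm => (f y)%:E) by exact/measurable_EFinP.
rewrite (integral_dyadic_index j g g0) -nneseriesZl; last first.
  by move=> m _; rewrite adde_ge0// lee_fin mulr_ge0 ?invr_ge0 ?exprn_ge0.
rewrite /dyadic_product ge0_integral_measure_series//; last first.
  by move=> y _; rewrite lee_fin.
have atomE k : (\int[dyadic_atom P j k]_y (f y)%:E = (2 ^+ j * (g k * 2 ^- j))%:E)%E.
  rewrite /dyadic_atom ge0_integral_mscale//; last by move=> y _; rewrite lee_fin.
  rewrite integral_dirac// diracT mul1e -EFinM/=; congr EFin.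
  by rewrite /g mulrCA divff ?mulr1 1?mulrC// expf_neq0.
apply: eq_eseriesr => m _.
rewrite ge0_integral_measure_add//; last by move=> y _; rewrite lee_fin.
by rewrite !atomE -!EFinD -EFinM mulrDr.
Qed.

End dyadic_cells.

(** * Averages of a density over dyadic cells *)

Section cell_average.
Context {R : realType}.
Local Notation Rm := (measurableTypeR R).
Local Notation mu := (@lebesgue_measure R).

(** The average over the dyadic cell containing [y] of the density of [P]. *)
Definition cell_average (P : probability Rm R) (j : nat) (y : R) : R :=
  2 ^+ j * fine (P (dyadic_cell j (dyadic_index j y))).

(** The right endpoint of the dyadic cell containing [y]: the location of the
    atom that stands for this cell. *)
Definition dyadic_point (j : nat) (y : R) : R := (dyadic_index j y)%:~R * 2 ^- j.

Lemma near_exprV2_lt (e : R) : 0 < e -> \forall j \near \oo, 2 ^- j < e.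
Proof.
move=> e0; apply: filterS (near_infty_natSinv_expn_lt (PosNum e0)) => j /=.
by rewrite div1r.
Qed.

Lemma dyadic_cell_dist j k (y z : R) :
  dyadic_cell j k y -> dyadic_cell j k z -> `|z - y| <= 2 ^- j.
Proof.
rewrite /dyadic_cell/= !in_itv/= intrB mulrBl mul1r ler_norml => /andP[a b] /andP[c d].
by apply/andP; split; lra.
Qed.

Lemma dyadic_point_dist j (y : R) : `|dyadic_point j y - y| <= 2 ^- j.
Proof.
have : dyadic_cell j (dyadic_index j y) y by apply/dyadic_cellP.
rewrite /dyadic_cell/= in_itv/= -/(dyadic_point j y) intrB mulrBl mul1r.
rewrite -/(dyadic_point j y) ler_norml => /andP[a b].
by apply/andP; split; lra.
Qed.

Lemma cvg_dyadic_point (y : R) : dyadic_point j y @[j --> \oo] --> y.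
Proof.
apply/cvgrPdist_lt => e e0; apply: filterS (near_exprV2_lt _ e0) => j.
by apply: le_lt_trans; rewrite distrC; exact: dyadic_point_dist.
Qed.

Section density.
Variables (P : probability Rm R) (q : R -> R).
Hypotheses (q0 : forall x, 0 <= q x) (cq : continuous q).
Hypothesis Pq : forall A, measurable A -> P A = (\int[mu]_(x in A) (q x)%:E)%E.

Let mq A : measurable_fun (A : set Rm) (EFin \o q : Rm -> \bar R).
Proof.
apply/measurable_EFinP; apply: measurable_funTS.
exact: continuous_measurable_fun.
Qed.

Lemma cell_average_le j y u :
  (forall z, dyadic_cell j (dyadic_index j y) z -> q z <= u) ->
  cell_average P j y <= u.
Proof.
move=> h; set D := dyadic_cell j _ in h *.
have mD : measurable D by exact: measurable_dyadic_cell.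
have u0 : 0 <= u.
  by rewrite (le_trans (q0 y))//; apply: h; exact/dyadic_cellP.
rewrite /cell_average mulrC -ler_pdivlMr ?exprn_gt0// -lee_fin.
rewrite fineK ?fin_num_measure//.
rewrite Pq// EFinM -(lebesgue_measure_dyadic_cell j (dyadic_index j y)) -/D.
rewrite -integral_cst//; apply: ge0_le_integral => //.
by move=> x _; rewrite lee_fin.
Qed.

Lemma cell_average_ge j y u :
  (forall z, dyadic_cell j (dyadic_index j y) z -> u <= q z) ->
  u <= cell_average P j y.
Proof.
move=> h; set D := dyadic_cell j _ in h *.
have mD : measurable D by exact: measurable_dyadic_cell.
have [u0|u0] := leP 0 u; last first.
  by rewrite (le_trans (ltW u0))// mulr_ge0// fine_ge0.
rewrite /cell_average mulrC -ler_pdivrMr ?exprn_gt0// -lee_fin.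
rewrite fineK ?fin_num_measure//.
rewrite Pq// EFinM -(lebesgue_measure_dyadic_cell j (dyadic_index j y)) -/D.
rewrite -integral_cst//; apply: ge0_le_integral => //.
Qed.

Lemma cvg_cell_average (y : R) : cell_average P j y @[j --> \oo] --> q y.
Proof.
apply/cvgrPdist_le => e e0.
have /cvgrPdist_le/(_ e e0) /nbhs_ballP[r /= r0 hr] := cq y.
apply: filterS (near_exprV2_lt _ r0) => j jr.
have hz z : dyadic_cell j (dyadic_index j y) z -> `|q y - q z| <= e.
  move=> Dz; apply: hr; rewrite /ball/= distrC.
  by rewrite (le_lt_trans _ jr)//; apply: dyadic_cell_dist Dz; exact/dyadic_cellP.
rewrite ler_distlC; apply/andP; split.
- apply: cell_average_ge => z /hz; rewrite ler_distlC => /andP[]//.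
- apply: cell_average_le => z /hz; rewrite ler_distlC => /andP[]//.
Qed.

End density.

Lemma cell_average_ge0 P j y : 0 <= cell_average P j y.
Proof. by rewrite mulr_ge0// fine_ge0. Qed.

Lemma measurable_cell_average P j : measurable_fun [set: R] (cell_average P j).
Proof.
exact: (measurable_dyadic_index j (fun k => 2 ^+ j * fine (P (dyadic_cell j k)))).
Qed.

Lemma measurable_dyadic_point j : measurable_fun [set: R] (dyadic_point j).
Proof. exact: (measurable_dyadic_index j (fun k => k%:~R * 2 ^- j)). Qed.

Lemma dyadic_weight_cell_average n (P : 'I_n -> probability Rm R) j y :
  dyadic_weight P j (dyadic_index j y) =
  (2 ^- j) ^+ n * \prod_i cell_average (P i) j y.
Proof.
rewrite -[X in _ ^+ X]card_ord -prodr_const -big_split/=.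
by apply: eq_bigr => i _; rewrite /cell_average mulKf// expf_neq0.
Qed.

End cell_average.

(** * Conflations of continuous densities *)

Lemma continuous_vanishing_bounded {R : realType} (f : R -> R) :
  continuous f -> f x @[x --> +oo] --> (0 : R) -> f x @[x --> -oo] --> (0 : R) ->
  exists M, forall x, `|f x| <= M.
Proof.
move=> cf /cvgr0Pnorm_le/(_ 1 ltr01)[A [_ hA]] /cvgr0Pnorm_le/(_ 1 ltr01)[B [_ hB]].
pose D := `|A| + `|B| + 1.
have D0 : - D <= D by rewrite ge0_cp// !addr_ge0.
have cabs : continuous (fun x => `|f x|) by move=> x; apply: cvg_norm; exact: cf.
have [c _ hc] := EVT_max D0 (continuous_subspaceT cabs).
exists (1 + `|f c|) => x.
have := ler_norm A; have := ler_norm (- B); rewrite normrN => b a.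
have := normr_ge0 A; have := normr_ge0 B => b0 a0.
have [xD|Dx] := leP x D; last first.
  by rewrite (le_trans (hA _ _)) ?lerDl//; move: Dx; rewrite /D; lra.
have [Dx|xD'] := leP (- D) x; last first.
  by rewrite (le_trans (hB _ _)) ?lerDl//; move: xD'; rewrite /D; lra.
by rewrite (le_trans (hc x _)) ?lerDr// in_itv/= Dx xD.
Qed.

Section conflation_of_densities.
Context {R : realType} {n : nat}.
Local Notation Rm := (measurableTypeR R).
Local Notation mu := (@lebesgue_measure R).
Variables (P : 'I_n -> probability Rm R) (q : 'I_n -> R -> R).
(* Domination: every density is bounded, and the supremum of one of them over
   the ball of radius 1 around y is at most g(y) for an integrable g. *)
Variables (K : 'I_n -> R) (i0 : 'I_n) (g : R -> R).
Hypotheses (q0 : forall i x, 0 <= q i x) (cq : forall i, continuous (q i)).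
Hypothesis Pq : forall i A, measurable A ->
  P i A = (\int[mu]_(x in A) (q i x)%:E)%E.
Hypothesis qK : forall i x, q i x <= K i.
Hypothesis ig : mu.-integrable setT (fun y => (g y)%:E).
Hypothesis qg : forall y z, `|z - y| <= 1 -> q i0 z <= g y.

Let cont_measurable (f : R -> R) : continuous f -> measurable_fun [set: R] f.
Proof. exact: continuous_measurable_fun. Qed.

(** Dominated convergence of the step functions to the product density. *)
Lemma cvg_integral_cell_average (f : R -> R) (M : R) :
  continuous f -> (forall x, 0 <= f x <= M) ->
  (\int[mu]_y (f (dyadic_point j y) * \prod_i cell_average (P i) j y)%:E)%E
    @[j --> \oo] --> (\int[mu]_y (f y * \prod_i q i y)%:E)%E.
Proof.
move=> cf fM.
have f0 x : 0 <= f x by have /andP[] := fM x.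
have M0 : 0 <= M by have /andP[_] := fM 0; exact: le_trans.
pose G y := M * (\prod_(i | i != i0) K i) * g y.
have mf := cont_measurable f cf.
have mI j : measurable_fun [set: Rm]
    (fun y : Rm => (f (dyadic_point j y) * \prod_i cell_average (P i) j y)%:E).
  apply/measurable_EFinP; apply: measurable_funM.
    exact: (measurableT_comp mf (measurable_dyadic_point j)).
  by apply: measurable_prod => i _; exact: measurable_cell_average.
have mL : measurable_fun [set: Rm] (fun y : Rm => (f y * \prod_i q i y)%:E).
  apply/measurable_EFinP; apply: measurable_funM => //.
  by apply: measurable_prod => i _; exact: cont_measurable.
have iG : mu.-integrable [set: Rm] (fun y : Rm => (G y)%:E).
  by rewrite /G; under eq_fun do rewrite EFinM; exact: integrableZl.
have [] := @dominated_convergence _ Rm R mu setT measurableT _ _ _ mI mL _ iG _ => //.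
- apply: aeW => y _; apply: cvg_EFin; first exact: nearW.
  apply: cvgM.
    exact: (cvg_comp _ _ (cvg_dyadic_point y) (cf y)).
  apply: (@cvg_big R _ *%R 1) => [|i _]; first exact: mul_continuous.
  exact: (cvg_cell_average _ _ (q0 i) (cq i) (Pq i)).
- apply: aeW => y j _; rewrite lee_fin ger0_norm; last first.
    by rewrite mulr_ge0// prodr_ge0// => i _; exact: cell_average_ge0.
  rewrite /G -mulrA ler_pM//.
  + by apply: prodr_ge0 => i _; exact: cell_average_ge0.
  + by have /andP[] := fM (dyadic_point j y).
  rewrite (bigD1 i0)//= mulrC ler_pM ?cell_average_ge0//.
  + by apply: prodr_ge0 => i _; exact: cell_average_ge0.
  + apply: ler_prod => i _; rewrite cell_average_ge0/=.
    by apply: (cell_average_le _ _ (q0 i) (cq i) (Pq i)) => z _; exact: qK.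
  + apply: (cell_average_le _ _ (q0 i0) (cq i0) (Pq i0)) => z Dz; apply: qg.
    rewrite (@le_trans _ _ (2 ^- j))//.
      by apply: dyadic_cell_dist Dz; exact/dyadic_cellP.
    by rewrite invf_le1 ?exprn_gt0// exprn_ege1// ler1n.
Qed.

(* [Q] has the normalized product of the densities as density [r]. *)
Variables (Q : probability Rm R) (c : R) (r : R -> R).
Hypothesis c0 : 0 < c.
Hypothesis r0 : forall x, 0 <= r x.
Hypothesis mr : measurable_fun [set: R] r.
Hypothesis qr : forall x, \prod_i q i x = c * r x.
Hypothesis Qr : forall f : R -> R, measurable_fun [set: R] f ->
  (forall x, 0 <= f x) ->
  (\int[Q]_x (f x)%:E = \int[mu]_x (f x * r x)%:E)%E.

Lemma integral_prod_density (f : R -> R) :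
  measurable_fun [set: R] f -> (forall x, 0 <= f x) ->
  (\int[mu]_y (f y * \prod_i q i y)%:E = c%:E * \int[Q]_y (f y)%:E)%E.
Proof.
move=> mf f0; rewrite Qr// -ge0_integralZl//.
- by apply: eq_integral => y _; rewrite qr -EFinM mulrCA.
- by apply/measurable_EFinP; exact: measurable_funM.
- by move=> y _; rewrite lee_fin mulr_ge0.
- by rewrite lee_fin ltW.
Qed.

Lemma cvg_integral_normalized_dyadic_product (f : R -> R) (M : R) :
  continuous f -> (forall x, 0 <= f x <= M) ->
  (\int[normalized (dyadic_product P j)]_y (f y)%:E)%E @[j --> \oo]
    --> (\int[Q]_y (f y)%:E)%E.
Proof.
move=> cf fM.
have f0 x : 0 <= f x by have /andP[] := fM x.
have mf := cont_measurable f cf.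
(* the integral of [h] against the discrete measure is [a j * I h j]; the
   factor [a j] does not depend on [h] and disappears by normalization *)
pose I (h : R -> R) j :=
  (\int[mu]_y (h (dyadic_point j y) * \prod_i cell_average (P i) j y)%:E)%E.
pose a j : R := 2 ^+ j * (2 ^- j) ^+ n.
have a0 j : 0 < a j by rewrite mulr_gt0 ?exprn_gt0 ?invr_gt0 ?exprn_gt0.
have IE (h : R -> R) (j : nat) : measurable_fun [set: R] h -> (forall x, 0 <= h x) ->
    (\int[dyadic_product P j]_y (h y)%:E = (a j)%:E * I h j)%E.
  move=> mh h0; rewrite integral_dyadic_product// EFinM -muleA; congr (_ * _)%E.
  rewrite -ge0_integralZl//.
  - apply: eq_integral => y _; rewrite dyadic_weight_cell_average -EFinM.
    by rewrite mulrCA.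
  - apply/measurable_EFinP; apply: measurable_funM.
      exact: (measurableT_comp mh (measurable_dyadic_point j)).
    by apply: measurable_prod => i _; exact: measurable_cell_average.
  - move=> y _; rewrite lee_fin mulr_ge0// prodr_ge0// => i _.
    exact: cell_average_ge0.
have massE j : dyadic_product P j setT = ((a j)%:E * I (fun=> 1%R) j)%E.
  by rewrite -IE// integral_cst// mul1e.
have Qfin : (\int[Q]_y (f y)%:E \is a fin_num)%E.
  rewrite ge0_fin_numE; last by apply: integral_ge0 => y _; rewrite lee_fin.
  apply: (@le_lt_trans _ _ (\int[Q]_y M%:E)%E).
    apply: ge0_le_integral => //.
    - by move=> y _; rewrite lee_fin.
    - exact/measurable_EFinP.
    - by move=> y _; rewrite lee_fin; have /andP[] := fM y.
  by rewrite integral_cst//= probability_setT mule1 ltry.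
have /fine_cvgP[If If'] : I f j @[j --> \oo] --> (c * fine (\int[Q]_y (f y)%:E))%:E.
  rewrite EFinM fineK// -integral_prod_density//.
  exact: cvg_integral_cell_average cf fM.
have /fine_cvgP[I1 I1'] : I (fun=> 1) j @[j --> \oo] --> c%:E.
  have -> : c%:E = (\int[mu]_y (1 * \prod_i q i y)%:E)%E.
    rewrite (@integral_prod_density (fun=> 1))// integral_cst//=.
    by rewrite mul1e probability_setT mule1.
  apply: (@cvg_integral_cell_average (fun=> 1) 1); first exact: cst_continuous.
  by move=> x; rewrite ler01 lexx.
have L : ((fine (I (fun=> 1) j))^-1 * fine (I f j))%:E @[j --> \oo]
    --> (\int[Q]_y (f y)%:E)%E.
  have -> : (\int[Q]_y (f y)%:E)%E = (c^-1 * (c * fine (\int[Q]_y (f y)%:E)))%:E.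
    by rewrite mulKf ?gt_eqF// fineK.
  apply: cvg_EFin; first exact: nearW.
  by apply: cvgM => //; apply: cvgV => //; rewrite gt_eqF.
apply: cvg_trans L; apply: near_eq_cvg.
apply: filterS2 If I1 => j fj f1.
rewrite ge0_integral_mscale//; last 2 first.
- exact/measurable_EFinP.
- by move=> y _; rewrite lee_fin.
rewrite /= massE IE// -(fineK fj) -(fineK f1) -!EFinM/=; congr EFin.
by rewrite invfM mulrACA mulVf ?mul1r// gt_eqF.
Qed.

(** The conflation of probabilities with dominated continuous densities has the
    normalized product of these densities as density. *)
Lemma is_conflation_density : is_conflation P Q.
Proof.
move=> f cf fy fNy.
have [M fM] := continuous_vanishing_bounded f cf fy fNy.
have cvg_part (h : R -> R) : continuous h -> (forall x, 0 <= h x <= M) ->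
    (\int[normalized (dyadic_product P j)]_y (h y)%:E)%E @[j --> \oo]
      --> (\int[Q]_y (h y)%:E)%E /\ (\int[Q]_y (h y)%:E \is a fin_num)%E.
  move=> ch hM; split; first exact: cvg_integral_normalized_dyadic_product ch hM.
  rewrite ge0_fin_numE; last first.
    by apply: integral_ge0 => y _; rewrite lee_fin; have /andP[] := hM y.
  apply: (@le_lt_trans _ _ (\int[Q]_y M%:E)%E); last first.
    by rewrite integral_cst//= probability_setT mule1 ltry.
  apply: ge0_le_integral => //.
  - by move=> y _; rewrite lee_fin; have /andP[] := hM y.
  - by apply/measurable_EFinP; exact: cont_measurable.
  - by move=> y _; rewrite lee_fin; have /andP[] := hM y.
pose fp (x : R) : R := Num.max (f x) 0.
pose fn (x : R) : R := Num.max (- f x) 0.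
have cfp : continuous fp.
  by move=> x; apply: (@continuous_max R R f (fun=> 0)); [exact: cf|exact: cvg_cst].
have cfn : continuous fn.
  move=> x; apply: (@continuous_max R R (fun x => - f x) (fun=> 0)).
    by apply: cvgN; exact: cf.
  exact: cvg_cst.
have M0 : 0 <= M by rewrite (le_trans _ (fM 0)).
have fpM x : 0 <= fp x <= M.
  by rewrite le_max lexx orbT/= ge_max M0 andbT (le_trans (ler_norm _)).
have fnM x : 0 <= fn x <= M.
  by rewrite le_max lexx orbT/= ge_max M0 andbT (le_trans (ler_norm _))// normrN.
have [cvgp finp] := cvg_part fp cfp fpM.
have [cvgn finn] := cvg_part fn cfn fnM.
have fE (nu : {measure set Rm -> \bar R}) :
    (\int[nu]_y (f y)%:E = \int[nu]_y (fp y)%:E - \int[nu]_y (fn y)%:E)%E.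
  rewrite integralE; congr (_ - _)%E; apply: eq_integral => y _.
    by rewrite funeposE /fp EFin_max.
  by rewrite funenegE /fn EFin_max.
rewrite fE; under eq_fun do rewrite fE.
by apply: cvgeB => //; exact: fin_num_adde_defr.
Qed.

End conflation_of_densities.

(** * Conflations of normal distributions and maximum likelihood *)

Section conflation_of_normals.
Context {R : realType}.
Local Notation Rm := (measurableTypeR R).
Local Notation mu := (@lebesgue_measure R).

(** The supremum of a normal density over the ball of radius 1 around y is at
    most a constant times the value at y of a normal density with a larger
    variance. *)
Lemma normal_pdf_le_dilation (m s y z : R) : 0 < s -> `|z - y| <= 1 ->
  normal_pdf m s z <=
  normal_peak s * expR (s ^+ 2 *+ 2)^-1 / normal_peak (2 * s)
  * normal_pdf m (2 * s) y.
Proof.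
move=> s0 zy.
have s20 : 0 < 2 * s by rewrite mulr_gt0.
rewrite !normal_pdfE ?gt_eqF// mulrA divfK ?gt_eqF ?normal_peak_gt0 ?gt_eqF//.
rewrite -mulrA ler_wpM2l ?normal_peak_ge0// -expRD ler_expR.
have -> : (s ^+ 2 *+ 2)^-1 + - (y - m) ^+ 2 / ((2 * s) ^+ 2 *+ 2) =
    (1 - (y - m) ^+ 2 / 4) / (s ^+ 2 *+ 2) by field; rewrite gt_eqF.
rewrite ler_wpM2r ?invr_ge0 ?mulrn_wge0 ?sqr_ge0//.
have zy2 : (z - y) ^+ 2 <= 1 by rewrite -real_normK ?num_real// expr_le1.
(* (y - m)^2 = 2 (z - m)^2 + 2 (z - y)^2 - ((z - m) + (z - y))^2 *)
have := sqr_ge0 ((z - m) + (z - y)); have := sqr_ge0 (z - m); nra.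
Qed.

Lemma is_conflation_normal_prob n (x s : 'I_n -> R) :
  (0 < n)%N -> (forall i, 0 < s i) ->
  is_conflation (fun i => normal_prob (x i) (s i) : probability Rm R)
    (normal_prob (weighted_mean s x) (pooled_sd s)).
Proof.
move=> n0 s0.
have sn0 i : s i != 0 by rewrite gt_eqF.
have [c c0 cE] := prod_normal_pdf s x n0 s0.
pose i0 := Ordinal n0.
pose C := normal_peak (s i0) * expR (s i0 ^+ 2 *+ 2)^-1 / normal_peak (2 * s i0).
apply: (@is_conflation_density R n _ (fun i => normal_pdf (x i) (s i))
  (fun i => normal_peak (s i)) i0 (fun y => C * normal_pdf (x i0) (2 * s i0) y)
  _ _ _ _ _ _ _ c (normal_pdf (weighted_mean s x) (pooled_sd s))) => //.
- by move=> i y; exact: normal_pdf_ge0.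
- by move=> i; exact: continuous_normal_pdf.
- by move=> i y; exact: normal_pdf_ub.
- under eq_fun do rewrite EFinM.
  by apply: integrableZl => //; exact: integrable_normal_pdf.
- by move=> y z; exact: normal_pdf_le_dilation.
- by move=> y; exact: normal_pdf_ge0.
- exact: measurable_normal_pdf.
- by move=> f mf f0; exact: ge0_integral_normal_prob.
Qed.

Lemma normal_prob_ext_mean (Q : probability Rm R) (m s : R) : s != 0 ->
  (forall A, measurable A -> Q A = normal_prob m s A) ->
  Q.-integrable setT (fun y => y%:E) /\ mean Q = m.
Proof.
move=> s0 QN.
have intE (f : R -> \bar R) : (\int[Q]_y f y = \int[normal_prob m s]_y f y)%E.
  by apply: eq_measure_integral => A mA _; exact: QN.
split.
  have /integrableP[mi i] := integrable_normal_prob_id m s s0.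
  by apply/integrableP; split => //; rewrite intE.
by rewrite /mean expectation.unlock intE integral_normal_prob_id.
Qed.

End conflation_of_normals.

Theorem theorem6p5 (R : realType) (d : measure_display) (T : measurableType d)
    (P_ : R -> probability T R) (n : nat) (X : 'I_n -> {mfun T >-> R})
    (sigma : 'I_n -> R) :
  (0 < n)%N ->
  (forall i, 0 < sigma i) ->
  (forall theta, independent_RVs (P_ theta) X) ->
  (forall theta i, has_normal_law (P_ theta) (X i)) ->
  (forall i, unbiased_estimator P_ (X i)) ->
  (forall theta i, 'V_(P_ theta)[X i] = (sigma i ^+ 2)%:E)%E ->
  let N w i : probability (measurableTypeR R) R := normal_prob (X i w) (sigma i) in
  (forall w, exists Q, is_conflation (N w) Q) /\
  forall Q : T -> probability (measurableTypeR R) R, (forall w, is_conflation (N w) (Q w)) ->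
    (forall w, (Q w).-integrable setT (fun x => x%:E)) /\
    is_MLE P_ X (fun w => mean (Q w)).
Proof.
move=> n0 s0 indep normal unbiased var N.
pose x w i := X i w.
have conf w : is_conflation (N w)
    (normal_prob (weighted_mean sigma (x w)) (pooled_sd sigma)).
  exact: is_conflation_normal_prob.
split; first by move=> w; exists (normal_prob (weighted_mean sigma (x w)) (pooled_sd sigma)).
move=> Q confQ.
have S0 : pooled_sd sigma != 0 by rewrite gt_eqF ?pooled_sd_gt0.
have QE w := normal_prob_ext_mean (Q w) _ _ S0
  (vague_limit_unique _ _ _ (confQ w) (conf w)).
split; first by move=> w; have [] := QE w.
have meanE w : mean (Q w) = weighted_mean sigma (x w) by have [] := QE w.
split.
  exists (fun t => weighted_mean sigma (tnth t)).
    apply: measurable_funM => //; apply: measurable_sum => i.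
    apply: measurable_funM => //.
    exact: (@measurable_tnth _ (measurableTypeR R) n i).
  apply/funext => w /=; rewrite meanE; congr (_ / _).
  by apply: eq_bigr => i _; rewrite tnth_mktuple.
exists (fun theta t => \prod_i normal_pdf theta (sigma i) (tnth t i)).
  move=> theta.
  have mq i : measurable_fun [set: R] (normal_pdf theta (sigma i)).
    exact: measurable_normal_pdf.
  have q0 i y : 0 <= normal_pdf theta (sigma i) y by exact: normal_pdf_ge0.
  split.
  - under eq_fun => v do under eq_bigr => i _ do rewrite tnth_mktuple.
    apply: continuous_big; first exact: mul_continuous.
    move=> i _ v; apply: (cvg_comp (fun v : 'rV[R]_n => v ord0 i)).
      exact: coord_continuous.
    by apply: continuous_normal_pdf; rewrite gt_eqF.
  - exact: (measurable_prod_tnth n (fun i => normal_pdf theta (sigma i)) mq).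
  - by move=> t; apply: prodr_ge0.
  - apply: (independent_joint_density (P_ theta) X
      (fun i => normal_pdf theta (sigma i))) => // i A mA.
    exact: has_normal_law_normal_prob (normal theta i) (s0 i) (unbiased i theta) (var theta i) A mA.
move=> w theta; rewrite meanE.
under eq_bigr => i _ do rewrite tnth_mktuple.
under [leRHS]eq_bigr => i _ do rewrite tnth_mktuple.
exact: prod_normal_pdf_le_weighted_mean.
Qed.
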